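(* Let $X=(X,\|\cdot\|)$ be a Banach space, let $(A_m)_{m\in\mathbb N}$ be a sequence of bounded linear operators on $X$, and let $(\|\cdot\|_m)_{m\in\mathbb N}$ be a sequence of norms on $X$, each equivalent to $\|\cdot\|$. Assume that there exists a closed subspace $Z\subset X$ such that $T_Z\colon(\mathcal D(T_Z),\|\cdot\|_{T_Z})\to Y_0$ is an invertible operator. Suppose furthermore that there exist $M,a>0$ such that $$\|\mathcal A(m,n)x\|_m\le M(m/n)^a\|x\|_n\quad\text{for all } m\ge n \text{ in } \mathbb N \text{ and } x\in X.$$ Then $(A_m)_{m\in\mathbb N}$ admits a polynomial dichotomy with respect to the sequence of norms $\|\cdot\|_m$.
   Context: $\mathbb N=\{1,2,3,\dots\}$. Set $\mathcal A(m,n)=A_{m-1}\cdots A_n$ if $m>n$ and $\mathcal A(n,n)=\mathrm{Id}$. Polynomial dichotomy: $(A_m)_{m\in\mathbb N}$ admits a polynomial dichotomy with respect to the sequence of norms $\|\cdot\|_m$ if (i) there exist projections $P_m$, $m\in\mathbb N$, on $X$ with $A_mP_m=P_{m+1}A_m$ for all $m\in\mathbb N$, such that each map $A_m|_{\operatorname{Ker}P_m}\colon\operatorname{Ker}P_m\to\operatorname{Ker}P_{m+1}$ is invertible; and (ii) there exist $\lambda,D>0$ such that for all $x\in X$ and $m,n\in\mathbb N$: $\|\mathcal A(m,n)P_nx\|_m\le D(m/n)^{-\lambda}\|x\|_n$ for $m\ge n$, and $\|\mathcal A(m,n)Q_nx\|_m\le D(n/m)^{-\lambda}\|x\|_n$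 for $m\le n$, where $Q_n=\mathrm{Id}-P_n$ and, for $m<n$, $\mathcal A(m,n)=(\mathcal A(n,m)|_{\operatorname{Ker}P_m})^{-1}\colon\operatorname{Ker}P_n\to\operatorname{Ker}P_m$. Sequence spaces: $Y$ is the Banach space of all sequences $\mathbf x=(x_m)_{m\in\mathbb N}\subset X$ with $\|\mathbf x\|_\infty:=\sup_{m\in\mathbb N}\|x_m\|_m<\infty$. For a closed subspace $Z\subset X$, $Y_Z=\{\mathbf x\in Y: x_1\in Z\}$, and $Y_0=Y_{\{0\}}$. Operator $T_Z$: $\mathcal D(T_Z)=\{\mathbf x\in Y_Z:\sup_{m\in\mathbb N}(m+1)\|x_{m+1}-A_mx_m\|_{m+1}<\infty\}$, and $T_Z\colon\mathcal D(T_Z)\to Y_0$ is given by $(T_Z\mathbf x)_1=0$, $(T_Z\mathbf x)_{m+1}=(m+1)(x_{m+1}-A_mx_m)$ for $m\in\mathbb N$. The space $\mathcal D(T_Z)$ is equipped with the graph norm $\|\mathbf x\|_{T_Z}=\|\mathbf x\|_\infty+\|T_Z\mathbf x\|_\infty$, for which it is a Banach space and $T_Z$ is bounded. Invertible means bijective (hence with bounded inverse). *)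

(* Defs.v *)
From Stdlib Require Import Reals ZArith.
From Coquelicot Require Import Coquelicot.

Set Implicit Arguments.
Unset Strict Implicit.
Unset Printing Implicit Defensive.

(** Stdlib reals with Coquelicot's normed modules.  The index set {1, 2, 3, ...}
    is [positive], so there is no index 0; [IZR (Zpos m)] is m as a real. *)

Open Scope R_scope.

Definition real_or_complex (K : AbsRing) : Prop :=
  K = R_AbsRing \/ K = C_AbsRing.

Definition bij_between (U V : Type) (D : U -> Prop) (E : V -> Prop) (f : U -> V)
  : Prop :=
  (forall x, D x -> E (f x)) /\
  (forall y, E y -> exists! x, D x /\ f x = y).

Section Defs.

Context {K : AbsRing} {X : CompleteNormedModule K}.

Record is_norm (N : X -> R) : Prop := IsNorm {
  is_norm_ge0 : forall x, 0 <= N x;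
  is_norm_eq0 : forall x, N x = 0 -> x = zero;
  is_norm_scal : forall (k : K) x, N (scal k x) = abs k * N x;
  is_norm_triangle : forall x y, N (plus x y) <= N x + N y }.

Definition equivalent_norm (N : X -> R) : Prop :=
  is_norm N /\
  exists c C, 0 < c /\ 0 < C /\ forall x, c * norm x <= N x <= C * norm x.

Record closed_subspace (Z : X -> Prop) : Prop := ClosedSubspace {
  closed_subspace_zero : Z zero;
  closed_subspace_plus : forall x y, Z x -> Z y -> Z (plus x y);
  closed_subspace_scal : forall (k : K) x, Z x -> Z (scal k x);
  closed_subspace_closed : closed Z }.

(** The integer p in K, i.e. 1 + ... + 1 (p terms). *)
Definition pos_scalar (p : positive) : K := Pos.iter_op plus p one.

Variables (A : positive -> X -> X) (N : positive -> X -> R).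

(** [fwd m n] = A_{m-1} ... A_n if m > n, and the identity if m = n
    (for m < n the value is the identity, a case which is never used). *)
Definition fwd (m n : positive) : X -> X :=
  Pos.peano_rect (fun _ => X -> X)
    (fun x => x)
    (fun k E => if (k <? n)%positive then fun x => x else fun x => A k (E x))
    m.

Definition ker (P : X -> X) (x : X) : Prop := P x = zero.

(** [evol P m n] extends [fwd m n] to m < n by the inverse of
    [fwd n m] : Ker P_m -> Ker P_n.  Here [iota] selects the unique element
    satisfying a predicate; it is meaningful on Ker P_n when this restriction
    is bijective, which [dichotomy_projections] ensures. *)
Definition evol (P : positive -> X -> X) (m n : positive) (x : X) : X :=
  if (n <=? m)%positive then fwd m n x
  else iota (fun y => ker (P m) y /\ fwd n m y = x).

Definition is_projection (P : X -> X) : Prop :=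
  is_linear P /\ forall x, P (P x) = P x.

Definition dichotomy_projections (P : positive -> X -> X) : Prop :=
  (forall m, is_projection (P m)) /\
  (forall m x, A m (P m x) = P (Pos.succ m) (A m x)) /\
  (forall m, bij_between (ker (P m)) (ker (P (Pos.succ m))) (A m)).

Definition polynomial_dichotomy : Prop :=
  exists P : positive -> X -> X,
    dichotomy_projections P /\
    exists lambda D : R, 0 < lambda /\ 0 < D /\
      forall (x : X) (m n : positive),
        ((n <= m)%positive ->
           N m (evol P m n (P n x)) <=
             D * Rpower (IZR (Zpos m) / IZR (Zpos n)) (- lambda) * N n x) /\
        ((m <= n)%positive ->
           N m (evol P m n (minus x (P n x))) <=
             D * Rpower (IZR (Zpos n) / IZR (Zpos m)) (- lambda) * N n x).

(** Finiteness of sup_m ||x_m||_m. *)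
Definition Y (x : positive -> X) : Prop :=
  exists C : R, forall m, N m (x m) <= C.

Definition Y_ (Z : X -> Prop) (x : positive -> X) : Prop := Y x /\ Z (x 1%positive).

Definition Y_0 : (positive -> X) -> Prop := Y_ (fun v => v = zero).

Definition dom_T (Z : X -> Prop) (x : positive -> X) : Prop :=
  Y_ Z x /\
  exists C : R, forall m : positive,
    IZR (Zpos (Pos.succ m)) *
      N (Pos.succ m) (minus (x (Pos.succ m)) (A m (x m))) <= C.

Definition T (x : positive -> X) (k : positive) : X :=
  if (k =? 1)%positive then zero
  else scal (pos_scalar k) (minus (x k) (A (Pos.pred k) (x (Pos.pred k)))).

(** T_Z is a bounded operator between Banach spaces (graph norm on the domain,
    sup norm on Y_0), so invertible means bijective: boundedness of the inverse
    is then automatic. *)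
Definition T_invertible (Z : X -> Prop) : Prop := bij_between (dom_T Z) Y_0 T.

End Defs.

(* Main.v *)
Require Import Defs.
From Stdlib Require Import Reals ZArith Lra Lia Ring Classical ClassicalEpsilon FunctionalExtensionality.
From mathcomp Require Import ssreflect.
From Coquelicot Require Import Coquelicot.

Open Scope R_scope.

(** Write [solves x g] for x_1 in Z and x_{m+1} = A_m x_m + g_m.  Invertibility of
    T_Z says that each g with (m+1) ||g_m||_{m+1} bounded has exactly one bounded
    solution x.  The graph of this correspondence is closed, so the open mapping
    argument ([bounded_inverse_of_closed_relation]) gives a constant C with
    sup_m ||x_m||_m <= C sup_m (m+1) ||g_m||_{m+1} ([admissibility]).  Everything
    else comes from testing this inequality on well chosen pairs (x, g).

    Splitting ([splitting]).  The unstable space at time n is A(n,1) Z, the stable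
    space consists of the vectors with bounded forward orbit.  Given v, let w be
    the orbit of v from time n on, faded out linearly between times n and 2n, and
    zero before n.  Its defect after time n is a forcing of size at most a
    multiple of ||v||_n: the slope 1/n of the fading compensates the weight m+1,
    and polynomial growth bounds the orbit on [n, 2n].  The bounded solution x for
    this forcing starts in Z and is free up to time n, so x_n is unstable; w - x
    is a free orbit from time n on, so v - x_n is stable.  This gives the
    decomposition of v and, at once, bounds independent of n for the forward orbit
    of the stable part and the backward orbit of the unstable part.  Uniqueness of
    bounded solutions makes the sum direct ([stable_unstable_zero]).

    Decay ([stable_decay], [unstable_decay]).  If u is a free orbit and chi a
    scalar weight, chi u solves the equation with g_m = (chi_{m+1} - chi_m) u_{m+1}
    ([weighted_orbit]).  For the weight w_m = (m/n)^lam, the factor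
    (m+1) (w_{m+1} - w_m) is at most 4 lam w_{m+1}.  Take chi = w - 1, stopped at
    the time l where w_m ||u_m||_m is maximal, with maximum b.  The inequality
    yields (w_l - 1) ||u_l||_l <= 4 lam C b, which is at most b / 2 when lam is
    small, whence b <= 2 sup_m ||u_m||_m.  The weight (n/m)^lam treats the unstable
    part in the same way. *)

(** * Real scalars *)

(** Weights and cut-offs are real whereas X is a space over K; only this embedding
    of R in K is needed to treat real and complex spaces together. *)
Record real_embedding (K : AbsRing) (rho : R -> K) : Prop := RealEmbedding {
  rho_plus : forall r s, rho (r + s) = plus (rho r) (rho s);
  rho_mult : forall r s, rho (r * s) = mult (rho r) (rho s);
  rho_one : rho 1 = one;
  rho_abs : forall r, abs (rho r) = Rabs r }.

Arguments rho_plus {K rho}.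
Arguments rho_mult {K rho}.
Arguments rho_one {K rho}.
Arguments rho_abs {K rho}.

Lemma real_embedding_exists (K : AbsRing) :
  real_or_complex K -> exists rho : R -> K, real_embedding K rho.
Proof.
  intros [-> | ->].
  - exists (fun r => r); split; reflexivity.
  - exists RtoC; split; intros.
    + apply RtoC_plus.
    + apply RtoC_mult.
    + reflexivity.
    + apply Cmod_R.
Qed.

Section Dichotomy.

Context {K : AbsRing} {X : CompleteNormedModule K}.
Context (rho : R -> K) (Hrho : real_embedding K rho).

Local Notation "r *: x" := (scal (rho r) x) (at level 40, left associativity).

Lemma rho_zero : rho 0 = zero.
Proof.
  apply (plus_reg_l (rho 0)).
  rewrite -(rho_plus Hrho) plus_zero_r; f_equal; ring.
Qed.

Lemma rho_opp (r : R) : rho (- r) = opp (rho r).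
Proof.
  apply (plus_reg_l (rho r)).
  rewrite -(rho_plus Hrho) plus_opp_r -rho_zero; f_equal; ring.
Qed.

Lemma pos_scalar_rho (p : positive) : pos_scalar p = rho (IZR (Zpos p)) :> K.
Proof.
  unfold pos_scalar.
  induction p as [|p IH] using Pos.peano_ind.
  - simpl; now rewrite (rho_one Hrho).
  - rewrite Pos.iter_op_succ; [|apply plus_assoc].
    rewrite IH Pos2Z.inj_succ succ_IZR Rplus_comm.
    now rewrite (rho_plus Hrho) (rho_one Hrho).
Qed.

(** * Deciding linear identities in X *)

(** R x X is a commutative ring for (a, x) (b, y) = (ab, ay + bx), in which X is an
    ideal of square zero.  A linear identity in X with real coefficients therefore
    becomes a commutative ring identity, which [ring] decides. *)

Definition ext : Type := (R * X)%type.
Definition ext_vec (x : X) : ext := (0, x).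
Definition ext_sc (r : R) : ext := (r, zero).
Definition ext_add (u v : ext) : ext := (fst u + fst v, plus (snd u) (snd v)).
Definition ext_opp (u : ext) : ext := (- fst u, opp (snd u)).
Definition ext_sub (u v : ext) : ext := ext_add u (ext_opp v).
Definition ext_mul (u v : ext) : ext :=
  (fst u * fst v, plus (fst u *: snd v) (fst v *: snd u)).

Lemma ext_ring :
  ring_theory (ext_sc 0) (ext_sc 1) ext_add ext_mul ext_sub ext_opp eq.
Proof.
  split; unfold ext_sc, ext_add, ext_mul, ext_sub, ext_opp; simpl.
  - intros [a x]; simpl; now rewrite plus_zero_l Rplus_0_l.
  - intros [a x] [b y]; simpl; now rewrite plus_comm Rplus_comm.
  - intros [a x] [b y] [c z]; simpl; now rewrite plus_assoc Rplus_assoc.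
  - intros [a x]; simpl.
    now rewrite (rho_one Hrho) scal_one scal_zero_r plus_zero_r Rmult_1_l.
  - intros [a x] [b y]; simpl; now rewrite plus_comm Rmult_comm.
  - intros [a x] [b y] [c z]; simpl.
    rewrite !scal_distr_l !scal_assoc -!(rho_mult Hrho) plus_assoc.
    now rewrite Rmult_assoc (Rmult_comm c a) (Rmult_comm c b).
  - intros [a x] [b y] [c z]; simpl.
    rewrite !scal_distr_l (rho_plus Hrho) scal_distr_r Rmult_plus_distr_r.
    f_equal; rewrite -!plus_assoc; f_equal.
    rewrite !plus_assoc; f_equal; apply plus_comm.
  - reflexivity.
  - intros [a x]; simpl; now rewrite plus_opp_r Rplus_opp_r.
Qed.

Add Ring ext_ring : ext_ring.

Lemma ext_vec_inj (x y : X) : ext_vec x = ext_vec y -> x = y.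
Proof. now intros [= ->]. Qed.

Lemma ext_vec_plus (x y : X) :
  ext_vec (plus x y) = ext_add (ext_vec x) (ext_vec y).
Proof. unfold ext_vec, ext_add; simpl; now rewrite Rplus_0_l. Qed.

Lemma ext_vec_opp (x : X) : ext_vec (opp x) = ext_opp (ext_vec x).
Proof. unfold ext_vec, ext_opp; simpl; now rewrite Ropp_0. Qed.

Lemma ext_vec_scal (r : R) (x : X) :
  ext_vec (r *: x) = ext_mul (ext_sc r) (ext_vec x).
Proof.
  unfold ext_vec, ext_mul, ext_sc; simpl.
  now rewrite Rmult_0_r scal_zero_r plus_zero_r.
Qed.

Lemma ext_vec_zero : ext_vec zero = ext_sc 0.
Proof. reflexivity. Qed.

Lemma ext_sc_plus (r s : R) : ext_sc (r + s) = ext_add (ext_sc r) (ext_sc s).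
Proof. unfold ext_sc, ext_add; simpl; now rewrite plus_zero_r. Qed.

Lemma ext_sc_opp (r : R) : ext_sc (- r) = ext_opp (ext_sc r).
Proof.
  unfold ext_sc, ext_opp; simpl; f_equal.
  now rewrite -(plus_zero_l (opp zero)) plus_opp_r.
Qed.

Lemma ext_sc_mult (r s : R) : ext_sc (r * s) = ext_mul (ext_sc r) (ext_sc s).
Proof.
  unfold ext_sc, ext_mul; simpl; now rewrite !scal_zero_r plus_zero_r.
Qed.

Ltac module_eq :=
  apply ext_vec_inj; unfold minus, Rminus;
  repeat (rewrite ?ext_vec_plus ?ext_vec_opp ?ext_vec_scal ?ext_vec_zero);
  repeat (rewrite ?ext_sc_plus ?ext_sc_opp ?ext_sc_mult);
  ring.

Lemma minus_zero_eq (x y : X) : minus x y = zero -> x = y.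
Proof.
  intros H; replace x with (plus (minus x y) y) by module_eq.
  rewrite H; module_eq.
Qed.

(** * Norms equivalent to the given one *)

Lemma norm_rscal (p : X -> R) (r : R) (x : X) :
  is_norm p -> p (r *: x) = Rabs r * p x.
Proof. intros Hp; now rewrite (is_norm_scal Hp) (rho_abs Hrho). Qed.

Lemma norm_zero_at (p : X -> R) : is_norm p -> p zero = 0.
Proof.
  intros Hp.
  replace (zero : X) with (0 *: (zero : X)) by module_eq.
  rewrite (norm_rscal p _ _ Hp) Rabs_R0; ring.
Qed.

Lemma norm_opp_at (p : X -> R) (x : X) : is_norm p -> p (opp x) = p x.
Proof.
  intros Hp.
  replace (opp x) with ((-(1)) *: x) by module_eq.
  rewrite (norm_rscal p _ _ Hp) Rabs_Ropp Rabs_R1; ring.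
Qed.

Lemma norm_minus_le (p : X -> R) (x y : X) :
  is_norm p -> p (minus x y) <= p x + p y.
Proof.
  intros Hp; unfold minus.
  rewrite -(norm_opp_at p y Hp); apply (is_norm_triangle Hp).
Qed.

(** The steps being controlled by a sequence that at least halves, the tail
    estimate holds with the same sequence; both uses of completeness below, nested
    balls and successive approximation, have this form. *)
Lemma complete_limit (p : X -> R) (u : nat -> X) (r : nat -> R) :
  equivalent_norm p ->
  (forall n, r (S n) <= r n / 2) ->
  (forall n, p (minus (u (S n)) (u n)) <= r n / 2) ->
  exists l, filterlim u eventually (locally l) /\
    forall n, p (minus l (u n)) <= r n.
Proof.
  intros [Hp [c [C [Hc [HC Heq]]]]] Hr Hu.
  assert (Hr0 : forall n, 0 <= r n).
  { intros n; generalize (is_norm_ge0 Hp (minus (u (S n)) (u n))) (Hu n); lra. }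
  assert (Htel : forall k n, p (minus (u (n + k)%nat) (u n)) <= r n - r (n + k)%nat).
  { induction k as [|k IH]; intros n.
    - rewrite Nat.add_0_r (minus_eq_zero (u n)) (norm_zero_at p Hp); lra.
    - rewrite Nat.add_succ_r.
      replace (minus (u (S (n + k))) (u n)) with
        (plus (minus (u (S (n + k))) (u (n + k)%nat)) (minus (u (n + k)%nat) (u n)))
        by module_eq.
      apply Rle_trans with (1 := is_norm_triangle Hp _ _).
      specialize (IH n); specialize (Hu (n + k)%nat); specialize (Hr (n + k)%nat).
      lra. }
  assert (Hgeom : forall n, r n <= r 0%nat * (/ 2) ^ n).
  { induction n as [|n IH]; simpl; [lra|]. generalize (Hr n); lra. }
  assert (Hsmall : forall eps, 0 < eps -> exists n, r n < eps).
  { intros eps He.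
    destruct (pow_lt_1_zero (/ 2)) with (y := eps / (r 0%nat + 1)) as [n Hn].
    - rewrite Rabs_pos_eq; lra.
    - apply Rdiv_lt_0_compat; [lra|]. generalize (Hr0 0%nat); lra.
    - exists n. specialize (Hn n (Nat.le_refl n)).
      assert (H0 := Hr0 0%nat).
      rewrite Rabs_pos_eq in Hn; [|apply pow_le; lra].
      apply Rle_lt_trans with (1 := Hgeom n).
      apply (Rmult_lt_compat_l (r 0%nat + 1)) in Hn; [|lra].
      replace ((r 0%nat + 1) * (eps / (r 0%nat + 1))) with eps in Hn by (field; lra).
      assert (0 < (/ 2) ^ n) by (apply pow_lt; lra). lra. }
  destruct (proj1 (filterlim_locally_cauchy (F := eventually) u)) as [l Hl].
  { intros eps.
    destruct (Hsmall (c * eps / 2)) as [n Hn].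
    { generalize (cond_pos eps); intros; nra. }
    exists (fun m => (n <= m)%nat); split; [now exists n|].
    intros i j Hi Hj; apply (norm_compat1 (V := X)).
    assert (Hi' := Htel (i - n)%nat n). assert (Hj' := Htel (j - n)%nat n).
    replace (n + (i - n))%nat with i in Hi' by lia.
    replace (n + (j - n))%nat with j in Hj' by lia.
    assert (H : p (minus (u j) (u i)) < c * eps).
    { replace (minus (u j) (u i)) with
        (minus (minus (u j) (u n)) (minus (u i) (u n))) by module_eq.
      apply Rle_lt_trans with (1 := norm_minus_le p _ _ Hp).
      generalize (Hr0 i) (Hr0 j); lra. }
    apply (Rmult_lt_reg_l c); [lra|].
    apply Rle_lt_trans with (1 := proj1 (Heq _)); exact H. }
  exists l; split; [exact Hl|].
  intros n; apply le_epsilon; intros eps He.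
  assert (He' : 0 < eps / C) by (apply Rdiv_lt_0_compat; lra).
  destruct (proj1 (filterlim_locally_ball_norm u l) Hl (mkposreal _ He')) as [k Hk].
  specialize (Hk (n + k)%nat ltac:(lia)); unfold ball_norm in Hk; simpl in Hk.
  replace (minus l (u n)) with
    (minus (minus (u (n + k)%nat) (u n)) (minus (u (n + k)%nat) l)) by module_eq.
  apply Rle_trans with (1 := norm_minus_le p _ _ Hp).
  apply Rplus_le_compat.
  - generalize (Htel k n) (Hr0 (n + k)%nat); lra.
  - apply Rle_trans with (1 := proj2 (Heq _)).
    apply Rle_trans with (C * (eps / C)); [|right; field; lra].
    apply Rmult_le_compat_l; [lra|apply Rlt_le, Hk].
Qed.

(** * Bounded inverse *)

Section OpenMapping.

Context {I : Type}.

Definition bounded_by (p : I -> X -> R) (c : R) (x : I -> X) : Prop :=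
  forall i, p i (x i) <= c.

Lemma complete_limit_family (p : I -> X -> R) (u : nat -> I -> X) (r : nat -> R) :
  (forall i, equivalent_norm (p i)) ->
  (forall n, r (S n) <= r n / 2) ->
  (forall n, bounded_by p (r n / 2) (fun i => minus (u (S n) i) (u n i))) ->
  exists l : I -> X,
    (forall i, filterlim (fun n => u n i) eventually (locally (l i))) /\
    forall n, bounded_by p (r n) (fun i => minus (l i) (u n i)).
Proof.
  intros Hn Hr Hu.
  assert (H : forall i, exists l,
    filterlim (fun n => u n i) eventually (locally l) /\
    forall n, p i (minus l (u n i)) <= r n).
  { intros i; apply complete_limit; [apply Hn|exact Hr|].
    intros n; apply (Hu n i). }
  exists (fun i => proj1_sig (constructive_indefinite_description _ (H i))).
  split; intros i; [|intros j];
    destruct (constructive_indefinite_description _ (H _)) as [l [Hl1 Hl2]];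
    simpl; auto.
Qed.

Context (p q : I -> X -> R).
Context (Hp : forall i, equivalent_norm (p i)).
Context (Hq : forall i, equivalent_norm (q i)).

(** Baire's theorem for the sequences bounded in the norms q: otherwise each ball
    contains a smaller one disjoint from G n, and the common point of a decreasing
    sequence of such balls lies in no G n. *)
Lemma baire_cover (G : nat -> (I -> X) -> Prop) :
  (forall g b, bounded_by q b g -> exists n, G n g) ->
  exists n g0 b0 r, 0 < r /\ bounded_by q b0 g0 /\
    forall g, bounded_by q r (fun i => minus (g i) (g0 i)) ->
    forall eps, 0 < eps ->
    exists z, G n z /\ bounded_by q eps (fun i => minus (g i) (z i)).
Proof.
  intros Hcover; apply NNPP; intros Hno.
  assert (Hstep : forall (n : nat) (s : (I -> X) * R), exists s' : (I -> X) * R,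
    0 < snd s -> (exists b, bounded_by q b (fst s)) ->
    (exists b, bounded_by q b (fst s')) /\ 0 < snd s' /\ snd s' <= snd s / 2 /\
    bounded_by q (snd s / 2) (fun i => minus (fst s' i) (fst s i)) /\
    forall z, G n z -> ~ bounded_by q (snd s') (fun i => minus (z i) (fst s' i))).
  { intros n [g0 r]; simpl.
    destruct (Rlt_le_dec 0 r) as [Hr|Hr]; [|exists (g0, r); intros; lra].
    destruct (classic (exists b, bounded_by q b g0)) as [[b0 Hb0]|Hb0];
      [|exists (g0, r); intros; tauto].
    (* half the radius leaves room for the ball to be chosen inside the old one *)
    apply NNPP; intros Hno'; apply Hno.
    exists n, g0, b0, (r / 2); split; [lra|split; [exact Hb0|]].
    intros g Hg eps Heps; apply NNPP; intros Hfar; apply Hno'.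
    exists (g, Rmin eps (r / 2)); simpl; intros _ _.
    assert (H1 := Rmin_l eps (r / 2)). assert (H2 := Rmin_r eps (r / 2)).
    split; [|split; [apply Rmin_glb_lt; lra|split; [exact H2|split; [exact Hg|]]]].
    - exists (r / 2 + b0); intros i.
      replace (g i) with (plus (minus (g i) (g0 i)) (g0 i)) by module_eq.
      apply Rle_trans with (1 := is_norm_triangle (proj1 (Hq i)) _ _).
      apply Rplus_le_compat; [apply Hg|apply Hb0].
    - intros z Hz Hclose; apply Hfar; exists z; split; [exact Hz|].
      intros i; apply Rle_trans with (2 := H1).
      rewrite -(norm_opp_at _ _ (proj1 (Hq i))).
      replace (opp (minus (g i) (z i))) with (minus (z i) (g i)) by module_eq.
      apply Hclose. }
  set (step n s := proj1_sig (constructive_indefinite_description _ (Hstep n s))).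
  assert (Hs : forall n s, 0 < snd s -> (exists b, bounded_by q b (fst s)) ->
    (exists b, bounded_by q b (fst (step n s))) /\ 0 < snd (step n s) /\
    snd (step n s) <= snd s / 2 /\
    bounded_by q (snd s / 2) (fun i => minus (fst (step n s) i) (fst s i)) /\
    forall z, G n z ->
      ~ bounded_by q (snd (step n s)) (fun i => minus (z i) (fst (step n s) i))).
  { intros n s; apply (proj2_sig (constructive_indefinite_description _ (Hstep n s))). }
  set (seq := nat_rect (fun _ => ((I -> X) * R)%type) ((fun _ => zero), 1) step).
  assert (Hseq : forall n, 0 < snd (seq n) /\ exists b, bounded_by q b (fst (seq n))).
  { induction n as [|n [H1 H2]]; simpl.
    - split; [lra|]. exists 0; intros i; rewrite (norm_zero_at _ (proj1 (Hq i))); lra.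
    - destruct (Hs n (seq n) H1 H2) as [H3 [H4 _]]; split; assumption. }
  destruct (complete_limit_family q (fun n => fst (seq n)) (fun n => snd (seq n)))
    as [l [_ Hl]].
  { exact Hq. }
  { intros n; apply (Hs n (seq n)); apply Hseq. }
  { intros n; apply (Hs n (seq n)); apply Hseq. }
  destruct (Hcover l 1) as [n Hn].
  { intros i; specialize (Hl 0%nat i); simpl in Hl.
    replace (l i) with (minus (l i) zero) by module_eq; exact Hl. }
  apply (Hs n (seq n) (proj1 (Hseq n)) (proj2 (Hseq n))) in Hn.
  apply Hn; exact (Hl (S n)).
Qed.

(** A relation rather than an operator: the unbounded operator T_Z, its domain and
    its inverse then need no description. *)
Context (Rel : (I -> X) -> (I -> X) -> Prop).
Context (Rel_plus : forall x y g h, Rel x g -> Rel y h ->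
  Rel (fun i => plus (x i) (y i)) (fun i => plus (g i) (h i))).
Context (Rel_scal : forall (r : R) x g, Rel x g ->
  Rel (fun i => r *: x i) (fun i => r *: g i)).
Context (Rel_closed : forall (xs gs : nat -> I -> X) x g,
  (forall n, Rel (xs n) (gs n)) ->
  (forall i, filterlim (fun n => xs n i) eventually (locally (x i))) ->
  (forall i, filterlim (fun n => gs n i) eventually (locally (g i))) ->
  Rel x g).
Context (Rel_total : forall g b, bounded_by q b g ->
  exists x c, Rel x g /\ bounded_by p c x).

(** The data solvable with norm at most n are dense in some ball, by Baire.
    Subtracting the centre of the ball moves it to the origin, and homogeneity
    makes the bound linear in b. *)
Lemma almost_solvable :
  exists c, 0 < c /\ forall b g, 0 < b -> bounded_by q b g ->
  exists x z, Rel x z /\ bounded_by p (c * b) x /\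
    bounded_by q (b / 2) (fun i => minus (g i) (z i)).
Proof.
  destruct (baire_cover (fun n g => exists x, Rel x g /\ bounded_by p (INR n) x))
    as [n [g0 [b0 [r [Hr [_ Hball]]]]]].
  { intros g b Hg; destruct (Rel_total g b Hg) as [x [c [Hx Hc]]].
    destruct (INR_unbounded c) as [n Hn].
    exists n, x; split; [exact Hx|].
    intros i; generalize (Hc i); lra. }
  assert (Hn := pos_INR n).
  exists ((2 * INR n + 1) / r); split; [apply Rdiv_lt_0_compat; lra|].
  intros b g Hb Hg.
  assert (Hrb : 0 < r / b) by (apply Rdiv_lt_0_compat; lra).
  destruct (Hball (fun i => plus (g0 i) ((r / b) *: g i))) with (eps := r / 4)
    as [z1 [[x1 [Hx1 Hn1]] Hz1]]; [|lra|].
  { intros i.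
    replace (minus (plus (g0 i) ((r / b) *: g i)) (g0 i)) with ((r / b) *: g i)
      by module_eq.
    rewrite (norm_rscal _ _ _ (proj1 (Hq i))) Rabs_pos_eq; [|lra].
    apply Rle_trans with (r / b * b); [|right; field; lra].
    apply Rmult_le_compat_l; [lra|apply Hg]. }
  destruct (Hball g0) with (eps := r / 4) as [z2 [[x2 [Hx2 Hn2]] Hz2]]; [|lra|].
  { intros i. rewrite (minus_eq_zero (g0 i)) (norm_zero_at _ (proj1 (Hq i))); lra. }
  exists (fun i => (b / r) *: plus (x1 i) ((-(1)) *: x2 i)).
  exists (fun i => (b / r) *: plus (z1 i) ((-(1)) *: z2 i)).
  assert (Hbr : 0 < b / r) by (apply Rdiv_lt_0_compat; lra).
  split; [|split].
  - apply (Rel_scal (b / r) _ (fun i => plus (z1 i) ((-(1)) *: z2 i))).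
    apply (Rel_plus _ (fun i => (-(1)) *: x2 i) _ (fun i => (-(1)) *: z2 i));
      [exact Hx1|apply (Rel_scal (-(1)) x2 z2 Hx2)].
  - intros i; rewrite (norm_rscal _ _ _ (proj1 (Hp i))) Rabs_pos_eq; [|lra].
    replace ((2 * INR n + 1) / r * b) with (b / r * (2 * INR n + 1)) by (field; lra).
    apply Rmult_le_compat_l; [lra|].
    replace (plus (x1 i) ((-(1)) *: x2 i)) with (minus (x1 i) (x2 i)) by module_eq.
    apply Rle_trans with (1 := norm_minus_le _ _ _ (proj1 (Hp i))).
    generalize (Hn1 i) (Hn2 i); lra.
  - intros i.
    replace (minus (g i) ((b / r) *: plus (z1 i) ((-(1)) *: z2 i))) with
      ((b / r) *: minus (minus (plus (g0 i) ((r / b) *: g i)) (z1 i))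
                        (minus (g0 i) (z2 i))).
    + rewrite (norm_rscal _ _ _ (proj1 (Hq i))) Rabs_pos_eq; [|lra].
      apply Rle_trans with (b / r * (r / 2)); [|right; field; lra].
      apply Rmult_le_compat_l; [lra|].
      apply Rle_trans with (1 := norm_minus_le _ _ _ (proj1 (Hq i))).
      generalize (Hz1 i) (Hz2 i); lra.
    + transitivity (minus ((b / r * (r / b)) *: g i)
        ((b / r) *: plus (z1 i) ((-(1)) *: z2 i))); [module_eq|].
      replace (b / r * (r / b)) with 1 by (field; lra); module_eq.
Qed.

(** Open mapping theorem: the data left unsolved halve at each step, so the
    solutions of the successive steps add up, and the relation is closed. *)
Theorem bounded_inverse_of_closed_relation :
  exists C, 0 < C /\ forall b g, 0 < b -> bounded_by q b g ->
  exists x, Rel x g /\ bounded_by p (C * b) x.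
Proof.
  destruct almost_solvable as [c [Hc Hsolve]].
  exists (2 * c); split; [lra|]; intros b g Hb Hg.
  set (r n := b * (/ 2) ^ n).
  assert (Hr : forall n, 0 < r n).
  { intros n; apply Rmult_lt_0_compat; [lra|apply pow_lt; lra]. }
  assert (HrS : forall n, r (S n) = r n / 2) by (intros n; unfold r; simpl; field).
  assert (Hstep : forall (n : nat) (f : I -> X), exists xz : (I -> X) * (I -> X),
    bounded_by q (r n) f ->
    Rel (fst xz) (snd xz) /\ bounded_by p (c * r n) (fst xz) /\
    bounded_by q (r n / 2) (fun i => minus (f i) (snd xz i))).
  { intros n f; destruct (classic (bounded_by q (r n) f)) as [Hf|Hf].
    - destruct (Hsolve (r n) f (Hr n) Hf) as [x [z Hxz]].
      exists (x, z); intros _; exact Hxz.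
    - exists (f, f); tauto. }
  set (step n f := proj1_sig (constructive_indefinite_description _ (Hstep n f))).
  assert (Hs : forall n f, bounded_by q (r n) f ->
    Rel (fst (step n f)) (snd (step n f)) /\
    bounded_by p (c * r n) (fst (step n f)) /\
    bounded_by q (r n / 2) (fun i => minus (f i) (snd (step n f) i))).
  { intros n f; apply (proj2_sig (constructive_indefinite_description _ (Hstep n f))). }
  (* the state is a partial sum of solutions and the part of g still unsolved *)
  set (seq := nat_rect (fun _ => ((I -> X) * (I -> X))%type) ((fun _ => zero), g)
    (fun n s => let xz := step n (snd s) in
       ((fun i => plus (fst s i) (fst xz i)), (fun i => minus (snd s i) (snd xz i))))).
  assert (Hrest : forall n, bounded_by q (r n) (snd (seq n))).
  { induction n as [|n IH].
    - intros i; unfold r; simpl; rewrite Rmult_1_r; apply Hg.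
    - rewrite HrS; exact (proj2 (proj2 (Hs n _ IH))). }
  assert (Hrel : forall n, Rel (fst (seq n)) (fun i => minus (g i) (snd (seq n) i))).
  { induction n as [|n IH].
    - destruct (Rel_total (fun _ => zero) 0) as [x [_ [Hx _]]].
      { intros i; rewrite (norm_zero_at _ (proj1 (Hq i))); lra. }
      apply (Rel_scal 0) in Hx.
      simpl; replace (fun i => minus (g i) (g i)) with (fun _ : I => 0 *: (zero : X)).
      + replace (fun _ : I => (zero : X)) with (fun i => 0 *: x i); [exact Hx|].
        apply functional_extensionality; intros i; module_eq.
      + apply functional_extensionality; intros i; module_eq.
    - replace (fun i => minus (g i) (snd (seq (S n)) i)) with
        (fun i => plus (minus (g i) (snd (seq n) i)) (snd (step n (snd (seq n))) i)).
      + apply (Rel_plus _ _ _ _ IH (proj1 (Hs n _ (Hrest n)))).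
      + apply functional_extensionality; intros i; simpl; module_eq. }
  destruct (complete_limit_family p (fun n => fst (seq n)) (fun n => 2 * c * r n))
    as [x [Hlim Hx]].
  { exact Hp. }
  { intros n; rewrite HrS; lra. }
  { intros n i; simpl.
    match goal with |- p i ?t <= _ => replace t with (fst (step n (snd (seq n))) i) by module_eq end.
    apply Rle_trans with (1 := proj1 (proj2 (Hs n _ (Hrest n))) i); lra. }
  exists x; split.
  - apply (Rel_closed _ _ _ _ Hrel Hlim).
    intros i.
    apply (filterlim_locally_ball_norm (fun n => minus (g i) (snd (seq n) i))).
    intros eps.
    destruct (Hq i) as [Hqn [c' [C' [Hc' [_ Heq]]]]].
    destruct (pow_lt_1_zero (/ 2)) with (y := c' * eps / b) as [n Hn].
    + rewrite Rabs_pos_eq; lra.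
    + apply Rdiv_lt_0_compat; [|lra]. apply Rmult_lt_0_compat; [lra|apply cond_pos].
    + exists n; intros m Hm; unfold ball_norm.
      apply (Rmult_lt_reg_l c'); [lra|].
      apply Rle_lt_trans with (1 := proj1 (Heq _)).
      assert (H : q i (minus (minus (g i) (snd (seq m) i)) (g i)) <= r m).
      { replace (minus (minus (g i) (snd (seq m) i)) (g i)) with
          (opp (snd (seq m) i)) by module_eq.
        rewrite (norm_opp_at _ _ Hqn); apply (Hrest m i). }
      apply Rle_lt_trans with (1 := H).
      specialize (Hn m Hm); rewrite Rabs_pos_eq in Hn; [|apply pow_le; lra].
      unfold r; apply (Rmult_lt_compat_l b) in Hn; [|lra].
      replace (b * (c' * eps / b)) with (c' * eps) in Hn by (field; lra); lra.
  - intros i; replace (x i) with (minus (x i) zero) by module_eq.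
    apply Rle_trans with (1 := Hx 0%nat i); unfold r; simpl; lra.
Qed.

End OpenMapping.

(** * The evolution family *)

Local Notation "# m" := (IZR (Zpos m)) (at level 1, format "# m").

Lemma succ_real (m : positive) : #(Pos.succ m) = #m + 1.
Proof. rewrite Pos2Z.inj_succ succ_IZR; reflexivity. Qed.

Lemma real_ge1 (m : positive) : 1 <= #m.
Proof. apply IZR_le; lia. Qed.

Lemma real_le (m n : positive) : (m <= n)%positive -> #m <= #n.
Proof. intros H; apply IZR_le; lia. Qed.

Context (A : positive -> X -> X) (N : positive -> X -> R).
Context (HA : forall m, is_linear (A m)).
Context (HN : forall m, equivalent_norm (N m)).

Let is_norm_N (m : positive) : is_norm (N m) := proj1 (HN m).

Lemma fwd_id (m n : positive) (x : X) : (m <= n)%positive -> fwd A m n x = x.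
Proof.
  unfold fwd; destruct m as [|m _] using Pos.peano_ind; intros H; [reflexivity|].
  rewrite Pos.peano_rect_succ.
  destruct (Pos.ltb_spec m n) as [_|H']; [reflexivity|lia].
Qed.

Lemma fwd_succ (m n : positive) (x : X) :
  (n <= m)%positive -> fwd A (Pos.succ m) n x = A m (fwd A m n x).
Proof.
  unfold fwd; intros H; rewrite Pos.peano_rect_succ.
  destruct (Pos.ltb_spec m n) as [H'|_]; [lia|reflexivity].
Qed.

Lemma fwd_trans (m k n : positive) (x : X) :
  (n <= k)%positive -> (k <= m)%positive ->
  fwd A m n x = fwd A m k (fwd A k n x).
Proof.
  intros Hnk; induction m as [|m IH] using Pos.peano_ind; intros Hkm.
  - replace k with 1%positive by lia; replace n with 1%positive by lia.
    reflexivity.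
  - destruct (Pos.eq_dec k (Pos.succ m)) as [->|Hk].
    + rewrite (fwd_id (Pos.succ m) (Pos.succ m)); [reflexivity|lia].
    + rewrite !(fwd_succ m) ?IH; try lia; reflexivity.
Qed.

Lemma fwd_plus (m n : positive) (x y : X) :
  fwd A m n (plus x y) = plus (fwd A m n x) (fwd A m n y).
Proof.
  induction m as [|m IH] using Pos.peano_ind.
  - rewrite !fwd_id; try lia; reflexivity.
  - destruct (Pos.ltb_spec m n) as [H|H].
    + rewrite !fwd_id; try lia; reflexivity.
    + rewrite !fwd_succ ?IH; try lia; apply (linear_plus _ (HA m)).
Qed.

Lemma fwd_scal (m n : positive) (k : K) (x : X) :
  fwd A m n (scal k x) = scal k (fwd A m n x).
Proof.
  induction m as [|m IH] using Pos.peano_ind.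
  - rewrite !fwd_id; try lia; reflexivity.
  - destruct (Pos.ltb_spec m n) as [H|H].
    + rewrite !fwd_id; try lia; reflexivity.
    + rewrite !fwd_succ ?IH; try lia; apply (linear_scal _ (HA m)).
Qed.

Lemma fwd_minus (m n : positive) (x y : X) :
  fwd A m n (minus x y) = minus (fwd A m n x) (fwd A m n y).
Proof.
  replace (minus x y) with (plus x ((-(1)) *: y)) by module_eq.
  rewrite fwd_plus fwd_scal; module_eq.
Qed.

(** * Admissibility *)

Context (Z : X -> Prop) (HZ : closed_subspace Z) (HT : T_invertible A N Z).

(** With g_m = (T_Z x)_{m+1} / (m+1), this is the equation T_Z x = y without the
    trivial component y_1 = 0. *)
Definition solves (x g : positive -> X) : Prop :=
  Z (x 1%positive) /\ forall m, x (Pos.succ m) = plus (A m (x m)) (g m).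

(** The norm of y_{m+1} = (m+1) g_m at time m+1. *)
Definition forcing_norm (m : positive) (v : X) : R :=
  #(Pos.succ m) * N (Pos.succ m) v.

Lemma equivalent_forcing_norm (m : positive) : equivalent_norm (forcing_norm m).
Proof.
  destruct (HN (Pos.succ m)) as [Hn [c [C [Hc [HC Heq]]]]].
  assert (H1 := real_ge1 (Pos.succ m)); unfold forcing_norm.
  split; [split|].
  - intros x; generalize (is_norm_ge0 Hn x); intros; nra.
  - intros x Hx; apply (is_norm_eq0 Hn); nra.
  - intros k x; rewrite (is_norm_scal Hn); ring.
  - intros x y; generalize (is_norm_triangle Hn x y); intros; nra.
  - exists (#(Pos.succ m) * c), (#(Pos.succ m) * C).
    split; [nra|split; [nra|]]; intros x; specialize (Heq x).
    rewrite !Rmult_assoc; split; apply Rmult_le_compat_l; lra.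
Qed.

Lemma T_succ (x : positive -> X) (m : positive) :
  T A x (Pos.succ m) = #(Pos.succ m) *: minus (x (Pos.succ m)) (A m (x m)).
Proof.
  unfold T; destruct (Pos.eqb_spec (Pos.succ m) 1) as [H|_]; [lia|].
  now rewrite Pos.pred_succ pos_scalar_rho.
Qed.

Lemma bounded_solution_unique (x : positive -> X) (c : R) :
  solves x (fun _ => zero) -> bounded_by N c x -> forall m, x m = zero.
Proof.
  intros [Hx1 Hx] Hb.
  destruct (proj2 HT (fun _ => zero)) as [w [_ Hw]].
  { split; [exists 0|reflexivity]; intros m.
    rewrite (norm_zero_at _ (is_norm_N m)); lra. }
  assert (H0 : forall m, A m zero = zero).
  { intros m; replace (zero : X) with (0 *: (zero : X)) by module_eq.
    rewrite (linear_scal _ (HA m)); module_eq. }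
  assert (Hdom : forall u : positive -> X, Z (u 1%positive) -> Y N u ->
    (forall m, u (Pos.succ m) = A m (u m)) -> dom_T A N Z u /\ T A u = fun _ => zero).
  { intros u Hu1 Hub Hu; split; [split; [split; assumption|]|].
    - exists 0; intros m; rewrite Hu (minus_eq_zero (A m (u m))).
      rewrite (norm_zero_at _ (is_norm_N _)); lra.
    - apply functional_extensionality; intros m.
      destruct (Pos.eq_dec m 1) as [->|Hm]; [reflexivity|].
      rewrite -(Pos.succ_pred m Hm) T_succ Hu; module_eq. }
  intros m; transitivity (w m).
  - symmetry; revert m; apply equal_f, Hw, Hdom; [exact Hx1|now exists c|].
    intros m; rewrite Hx; module_eq.
  - revert m; apply (equal_f (g := fun _ => zero)), Hw.
    apply (Hdom (fun _ => zero)); [apply (closed_subspace_zero HZ)| |].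
    + exists 0; intros m; rewrite (norm_zero_at _ (is_norm_N m)); lra.
    + intros m; symmetry; apply H0.
Qed.

Lemma bounded_solution_exists (g : positive -> X) (b : R) :
  bounded_by forcing_norm b g ->
  exists x c, solves x g /\ bounded_by N c x.
Proof.
  intros Hg.
  set (y := fun k => if (k =? 1)%positive then zero else #k *: g (Pos.pred k)).
  assert (Hy : forall m, y (Pos.succ m) = #(Pos.succ m) *: g m).
  { intros m; unfold y; destruct (Pos.eqb_spec (Pos.succ m) 1) as [H|_]; [lia|].
    now rewrite Pos.pred_succ. }
  destruct (proj2 HT y) as [x [[[[[c Hc] Hx1] _] Hx] _]].
  { split; [|reflexivity]; exists (Rmax 0 b); intros m.
    destruct (Pos.eq_dec m 1) as [->|Hm].
    - unfold y; simpl; rewrite (norm_zero_at _ (is_norm_N _)); apply Rmax_l.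
    - rewrite -(Pos.succ_pred m Hm) Hy (norm_rscal _ _ _ (is_norm_N _)).
      rewrite Rabs_pos_eq; [|generalize (real_ge1 (Pos.succ (Pos.pred m))); lra].
      apply Rle_trans with (2 := Rmax_r 0 b); apply Hg. }
  exists x, c; split; [split; [exact Hx1|]|exact Hc].
  intros m.
  assert (Hm := equal_f Hx (Pos.succ m)); rewrite T_succ Hy in Hm.
  assert (H1 := real_ge1 (Pos.succ m)).
  replace (x (Pos.succ m)) with (plus (A m (x m))
    ((/ #(Pos.succ m) * #(Pos.succ m)) *: minus (x (Pos.succ m)) (A m (x m)))).
  - rewrite (rho_mult Hrho) -scal_assoc Hm scal_assoc -(rho_mult Hrho) Rinv_l; [|lra].
    module_eq.
  - rewrite Rinv_l; [|lra]; module_eq.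
Qed.

(** Stated for an arbitrary bounded solution: by uniqueness it is the one provided
    by the open mapping theorem, applied with bounds b + eps since that theorem
    needs a positive bound. *)
Lemma admissibility :
  exists C, 0 < C /\ forall x g b c, solves x g -> bounded_by N c x ->
    0 <= b -> bounded_by forcing_norm b g -> bounded_by N (C * b) x.
Proof.
  destruct (bounded_inverse_of_closed_relation N forcing_norm HN equivalent_forcing_norm solves)
    as [C [HC Hsol]].
  - intros x y g h [Hx1 Hx] [Hy1 Hy]; split.
    + apply (closed_subspace_plus HZ); assumption.
    + intros m; rewrite Hx Hy (linear_plus _ (HA m)); module_eq.
  - intros r x g [Hx1 Hx]; split.
    + apply (closed_subspace_scal HZ); assumption.
    + intros m; rewrite Hx (linear_scal _ (HA m)); module_eq.
  - intros xs gs x g Hs Hxs Hgs; split.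
    + refine (closed_filterlim (F := eventually) (fun n => xs n 1%positive) Z _
        (Hxs _) (fun n => proj1 (Hs n)) _).
      apply (closed_subspace_closed HZ).
    + intros m.
      apply (filterlim_locally_unique (F := eventually)
        (fun n => xs n (Pos.succ m))); [apply Hxs|].
      apply (filterlim_ext (fun n => plus (A m (xs n m)) (gs n m))).
      { intros n; symmetry; apply Hs. }
      apply (filterlim_comp_2 (G := locally (A m (x m))) (H := locally (g m)));
        [|apply Hgs|apply (filterlim_plus (V := X))].
      apply (filterlim_comp _ _ _ (fun n => xs n m) (A m) _ (locally (x m)));
        [apply Hxs|apply (linear_cont (A m)), HA].
  - exact bounded_solution_exists.
  - exists C; split; [exact HC|].
    intros x g b c [Hx1 Hx] Hc Hb Hg m.
    apply le_epsilon; intros eps Heps.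
    assert (He : 0 < eps / C) by (apply Rdiv_lt_0_compat; lra).
    destruct (Hsol (b + eps / C) g) as [x' [[Hx1' Hx'] Hb']]; [lra| |].
    { intros i; generalize (Hg i); lra. }
    replace (x m) with (x' m).
    { apply Rle_trans with (1 := Hb' m); right; field; lra. }
    apply minus_zero_eq.
    apply (bounded_solution_unique (fun k => minus (x' k) (x k))
      (C * (b + eps / C) + c)).
    + split.
      * replace (minus (x' 1%positive) (x 1%positive)) with
          (plus (x' 1%positive) ((-(1)) *: x 1%positive)) by module_eq.
        apply (closed_subspace_plus HZ); [exact Hx1'|].
        apply (closed_subspace_scal HZ); exact Hx1.
      * intros k; rewrite Hx Hx'.
        replace (minus (x' k) (x k)) with (plus (x' k) ((-(1)) *: x k)) by module_eq.
        rewrite (linear_plus _ (HA k)) (linear_scal _ (HA k)); module_eq.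
    + intros k; apply Rle_trans with (1 := norm_minus_le _ _ _ (is_norm_N k)).
      apply Rplus_le_compat; [apply Hb'|apply Hc].
Qed.

(** * Weights *)

Lemma argmax (f : positive -> R) (l n : positive) :
  (l <= n)%positive -> exists k0, (l <= k0 <= n)%positive /\
    forall k, (l <= k <= n)%positive -> f k <= f k0.
Proof.
  induction n as [|n IH] using Pos.peano_ind; intros Hln.
  - exists 1%positive; split; [lia|]; intros k Hk.
    replace k with 1%positive by lia; lra.
  - destruct (Pos.eq_dec l (Pos.succ n)) as [->|Hl].
    + exists (Pos.succ n); split; [lia|]; intros k Hk.
      replace k with (Pos.succ n) by lia; lra.
    + destruct IH as [k0 [Hk0 Hmax]]; [lia|].
      destruct (Rle_lt_dec (f (Pos.succ n)) (f k0)) as [Hf|Hf].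
      * exists k0; split; [lia|]; intros k Hk.
        destruct (Pos.eq_dec k (Pos.succ n)) as [->|Hk']; [exact Hf|apply Hmax; lia].
      * exists (Pos.succ n); split; [lia|]; intros k Hk.
        destruct (Pos.eq_dec k (Pos.succ n)) as [->|Hk']; [lra|].
        apply Rle_trans with (2 := Rlt_le _ _ Hf); apply Hmax; lia.
Qed.

Lemma Rpower_pos (x y : R) : 0 < Rpower x y.
Proof. apply exp_pos. Qed.

Lemma Rpower_one_l (y : R) : Rpower 1 y = 1.
Proof. unfold Rpower; now rewrite ln_1 Rmult_0_r exp_0. Qed.

(** With t = lam/k the quotient of consecutive powers is at most exp t, and
    exp t <= 1 + 2t for t <= 1/2; the last factor 2 is (k+1)/k <= 2. *)
Lemma power_step (lam : R) (k : positive) :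
  0 <= lam <= / 2 ->
  1 <= Rpower (#(Pos.succ k) / #k) lam /\
  #(Pos.succ k) * (Rpower (#(Pos.succ k) / #k) lam - 1) <= 4 * lam.
Proof.
  intros Hlam; assert (Hk := real_ge1 k); rewrite succ_real.
  assert (Hik : 0 < / #k <= 1).
  { split; [apply Rinv_0_lt_compat; lra|].
    assert (H := Rinv_le_contravar 1 #k Rlt_0_1 Hk); rewrite Rinv_1 in H; exact H. }
  replace ((#k + 1) / #k) with (1 + / #k) by (field; lra).
  split.
  - apply Rle_trans with (Rpower 1 lam); [rewrite Rpower_one_l; lra|].
    apply Rle_Rpower_l; lra.
  - assert (Hln : ln (1 + / #k) <= / #k).
    { rewrite -{2}(ln_exp (/ #k)); apply ln_le; [lra|apply exp_ineq1_le]. }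
    set (t := lam * / #k).
    assert (Ht : 0 <= t <= / 2) by (unfold t; nra).
    assert (He : Rpower (1 + / #k) lam <= exp t).
    { apply Rnot_lt_le; intros H; apply exp_lt_inv in H.
      generalize (Rmult_le_compat_l lam _ _ (proj1 Hlam) Hln); unfold t in H; lra. }
    assert (He1 := exp_ineq1_le (- t)).
    assert (He2 : exp t * exp (- t) = 1).
    { rewrite -exp_plus; replace (t + - t) with 0 by ring; apply exp_0. }
    assert (He3 := exp_pos t).
    assert (He4 : exp t * (1 - t) <= 1).
    { rewrite -He2; apply Rmult_le_compat_l; lra. }
    assert (He5 : exp t - 1 <= 2 * t) by nra.
    apply Rle_trans with ((#k + 1) * (2 * t)); [apply Rmult_le_compat_l; lra|].
    replace ((#k + 1) * (2 * t)) with (2 * lam * (1 + / #k))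
      by (unfold t; field; lra).
    nra.
Qed.

(** From here on C bounds the inverse of T_Z. *)
Context (C : R) (C_pos : 0 < C).
Context (bounded_inverse : forall x g b c, solves x g -> bounded_by N c x ->
  0 <= b -> bounded_by forcing_norm b g -> bounded_by N (C * b) x).

(** The orbit relation is required only where chi does not vanish, so that an orbit
    which starts at a later time than 1 is allowed. *)
Lemma weighted_orbit (u : positive -> X) (chi : positive -> R) (c b : R) :
  (forall m, N m (chi m *: u m) <= c) ->
  Z (chi 1%positive *: u 1%positive) ->
  (forall m, chi m *: A m (u m) = chi m *: u (Pos.succ m)) ->
  0 <= b ->
  (forall m, #(Pos.succ m) * (Rabs (chi (Pos.succ m) - chi m) *
     N (Pos.succ m) (u (Pos.succ m))) <= b) ->
  forall m, Rabs (chi m) * N m (u m) <= C * b.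
Proof.
  intros Hc HZ1 Horb Hb Hinc m.
  rewrite -(norm_rscal _ _ _ (is_norm_N m)).
  apply (bounded_inverse (fun k => chi k *: u k)
    (fun k => (chi (Pos.succ k) - chi k) *: u (Pos.succ k)) b c);
    [split; [exact HZ1|]|exact Hc|exact Hb|].
  - intros k; rewrite (linear_scal _ (HA k)) Horb; module_eq.
  - intros k; unfold forcing_norm; rewrite (norm_rscal _ _ _ (is_norm_N _)).
    apply Hinc.
Qed.

(** The decay rate: small with respect to 1/C, so that the forcing created by a
    weight of exponent lam costs at most half of what is estimated. *)
Context (lam : R) (lam_bounds : 0 < lam <= / 2) (lam_small : 8 * lam * C <= 1).

Definition slow_weight (w : positive -> R) : Prop :=
  (forall k, 0 < w k) /\
  forall k, #(Pos.succ k) * Rabs (w (Pos.succ k) - w k) <= 4 * lam * w (Pos.succ k).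

Lemma slow_weight_up (n : positive) : slow_weight (fun k => Rpower (#k / #n) lam).
Proof.
  split; intros k; [apply Rpower_pos|].
  destruct (power_step lam k) as [He1 He2]; [lra|].
  set (e := Rpower (#(Pos.succ k) / #k) lam) in *.
  assert (Hn := real_ge1 n). assert (Hk := real_ge1 k).
  assert (HkS := real_ge1 (Pos.succ k)).
  replace (Rpower (#(Pos.succ k) / #n) lam) with (Rpower (#k / #n) lam * e).
  - assert (Hw := Rpower_pos (#k / #n) lam).
    set (w := Rpower (#k / #n) lam) in *.
    replace (w * e - w) with (w * (e - 1)) by ring.
    rewrite Rabs_pos_eq; [|apply Rmult_le_pos; lra].
    apply Rle_trans with (w * (4 * lam)).
    + replace (#(Pos.succ k) * (w * (e - 1))) with (w * (#(Pos.succ k) * (e - 1)))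
        by ring.
      apply Rmult_le_compat_l; lra.
    + rewrite (Rmult_comm w); apply Rmult_le_compat_l; [lra|].
      rewrite -{1}(Rmult_1_r w); apply Rmult_le_compat_l; lra.
  - unfold e; rewrite Rpower_mult_distr; [f_equal; field; lra| |];
      apply Rdiv_lt_0_compat; lra.
Qed.

Lemma slow_weight_down (n : positive) : slow_weight (fun k => Rpower (#n / #k) lam).
Proof.
  split; intros k; [apply Rpower_pos|].
  destruct (power_step lam k) as [He1 He2]; [lra|].
  set (e := Rpower (#(Pos.succ k) / #k) lam) in *.
  assert (Hn := real_ge1 n). assert (Hk := real_ge1 k).
  assert (HkS := real_ge1 (Pos.succ k)).
  replace (Rpower (#n / #k) lam) with (Rpower (#n / #(Pos.succ k)) lam * e).
  - assert (Hw := Rpower_pos (#n / #(Pos.succ k)) lam).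
    set (w := Rpower (#n / #(Pos.succ k)) lam) in *.
    replace (w - w * e) with (- (w * (e - 1))) by ring.
    rewrite Rabs_Ropp Rabs_pos_eq; [|apply Rmult_le_pos; lra].
    replace (#(Pos.succ k) * (w * (e - 1))) with (w * (#(Pos.succ k) * (e - 1)))
      by ring.
    rewrite (Rmult_comm _ w); apply Rmult_le_compat_l; lra.
  - unfold e; rewrite Rpower_mult_distr; [f_equal; field; lra| |];
      apply Rdiv_lt_0_compat; lra.
Qed.

Definition clamp (i j k : positive) : positive := Pos.max i (Pos.min k j).

(** Stopping the weight outside [i, j] confines the forcing to times where the
    weighted orbit is bounded by b. *)
Lemma clamped_weight (w : positive -> R) (u : positive -> X) (i j : positive)
  (b c : R) :
  slow_weight w -> (i <= j)%positive -> 0 <= c ->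
  let chi k := w (clamp i j k) - 1 in
  Z (chi 1%positive *: u 1%positive) ->
  (forall k, chi k = 0 \/ N k (u k) <= c) ->
  (forall k, chi k = 0 \/ u (Pos.succ k) = A k (u k)) ->
  (forall k, (i <= k <= j)%positive -> w k * N k (u k) <= b) ->
  forall k, (i <= k <= j)%positive -> Rabs (w k - 1) * N k (u k) <= b / 2.
Proof.
  intros [Hw0 Hw] Hij Hc0 chi HZ1 Hc Horb Hb k Hk.
  assert (Hb0 : 0 <= b).
  { apply Rle_trans with (2 := Hb i ltac:(lia)), Rmult_le_pos;
      [apply Rlt_le, Hw0|apply (is_norm_ge0 (is_norm_N i))]. }
  apply Rle_trans with (C * (4 * lam * b)).
  - replace (w k) with (w (clamp i j k)) by (f_equal; unfold clamp; lia).
    destruct (argmax (fun k => Rabs (chi k)) i j Hij) as [l [_ Hl]].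
    apply (weighted_orbit u chi (Rabs (chi l) * c)); [|exact HZ1| | |].
    + intros m; rewrite (norm_rscal _ _ _ (is_norm_N m)).
      destruct (Hc m) as [H0|Hcm].
      * rewrite H0 Rabs_R0 Rmult_0_l; apply Rmult_le_pos; [apply Rabs_pos|lra].
      * apply Rmult_le_compat; [apply Rabs_pos|apply (is_norm_ge0 (is_norm_N m))| |
          exact Hcm].
        replace (chi m) with (chi (clamp i j m)) by
          (unfold chi; do 2 f_equal; unfold clamp; lia).
        apply Hl; unfold clamp; lia.
    + intros m; destruct (Horb m) as [H0|Hm]; [rewrite H0; module_eq|now rewrite Hm].
    + apply Rmult_le_pos; lra.
    + intros m; unfold chi.
      destruct (Pos.eq_dec (clamp i j (Pos.succ m)) (clamp i j m)) as [->|Hm].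
      { rewrite Rminus_diag Rabs_R0 Rmult_0_l Rmult_0_r; apply Rmult_le_pos; lra. }
      replace (clamp i j m) with m by (unfold clamp in *; lia).
      replace (clamp i j (Pos.succ m)) with (Pos.succ m) by (unfold clamp in *; lia).
      replace (w (Pos.succ m) - 1 - (w m - 1)) with (w (Pos.succ m) - w m) by ring.
      rewrite -Rmult_assoc.
      apply Rle_trans with (1 := Rmult_le_compat_r _ _ _
        (is_norm_ge0 (is_norm_N _) _) (Hw m)).
      rewrite Rmult_assoc; apply Rmult_le_compat_l; [lra|].
      apply Hb; unfold clamp in *; lia.
  - replace (C * (4 * lam * b)) with (8 * lam * C * (b / 2)) by field.
    rewrite -{2}(Rmult_1_l (b / 2)); apply Rmult_le_compat_r; lra.
Qed.

Lemma weight_at_base (n : positive) : Rpower (#n / #n) lam - 1 = 0.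
Proof.
  assert (Hn := real_ge1 n).
  rewrite /Rdiv Rinv_r; [rewrite Rpower_one_l; ring|lra].
Qed.

(** Here b = w y is the maximum that is being estimated; the half of it which
    reappears on the right is absorbed. *)
Lemma absorb_half (w y b c : R) :
  0 <= y -> Rabs (w - 1) * y <= b / 2 -> y <= c -> b = w * y -> b <= 2 * c.
Proof.
  intros Hy Hw Hyc Hb.
  generalize (Rmult_le_compat_r y _ _ Hy (Rle_abs (w - 1))); lra.
Qed.

Lemma stable_decay (n : positive) (v : X) (c : R) :
  (forall k, (n <= k)%positive -> N k (fwd A k n v) <= c) ->
  forall m, (n <= m)%positive ->
  Rpower (#m / #n) lam * N m (fwd A m n v) <= 2 * c.
Proof.
  intros Hc m Hnm.
  destruct (argmax (fun k => Rpower (#k / #n) lam * N k (fwd A k n v)) n m Hnm)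
    as [l [Hl Hmax]].
  apply Rle_trans with (1 := Hmax m ltac:(lia)).
  apply (absorb_half (Rpower (#l / #n) lam) (N l (fwd A l n v)));
    [apply (is_norm_ge0 (is_norm_N l))| |apply Hc; lia|reflexivity].
  assert (Hchi : forall k, (k <= n)%positive ->
    Rpower (#(clamp n l k) / #n) lam - 1 = 0).
  { intros k Hk; replace (clamp n l k) with n by (unfold clamp; lia).
    apply weight_at_base. }
  apply (clamped_weight (fun k => Rpower (#k / #n) lam) (fun k => fwd A k n v)
    n l _ c (slow_weight_up n)); [lia| | | | | |lia].
  - apply Rle_trans with (2 := Hc n ltac:(lia)), (is_norm_ge0 (is_norm_N n)).
  - rewrite Hchi; [|lia].
    match goal with |- Z ?t => replace t with (zero : X) by module_eq end.
    apply (closed_subspace_zero HZ).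
  - intros k; destruct (Pos.leb_spec k n); [left; now apply Hchi|right; apply Hc; lia].
  - intros k; destruct (Pos.leb_spec k n);
      [left; now apply Hchi|right; apply fwd_succ; lia].
  - intros k Hk; apply Hmax; lia.
Qed.

Lemma unstable_decay (n : positive) (z : X) (c : R) :
  Z z ->
  (forall k, (k <= n)%positive -> N k (fwd A k 1 z) <= c) ->
  forall m, (m <= n)%positive ->
  Rpower (#n / #m) lam * N m (fwd A m 1 z) <= 2 * c.
Proof.
  intros Hz Hc m Hmn.
  destruct (argmax (fun k => Rpower (#n / #k) lam * N k (fwd A k 1 z)) m n Hmn)
    as [l [Hl Hmax]].
  apply Rle_trans with (1 := Hmax m ltac:(lia)).
  apply (absorb_half (Rpower (#n / #l) lam) (N l (fwd A l 1 z)));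
    [apply (is_norm_ge0 (is_norm_N l))| |apply Hc; lia|reflexivity].
  apply (clamped_weight (fun k => Rpower (#n / #k) lam) (fun k => fwd A k 1 z)
    l n _ c (slow_weight_down n)); [lia| | | | | |lia].
  - apply Rle_trans with (2 := Hc n ltac:(lia)), (is_norm_ge0 (is_norm_N n)).
  - apply (closed_subspace_scal HZ); exact Hz.
  - intros k; destruct (Pos.leb_spec n k); [left|right; apply Hc; lia].
    replace (clamp l n k) with n by (unfold clamp; lia); apply weight_at_base.
  - intros k; right; apply fwd_succ; lia.
  - intros k Hk; apply Hmax; lia.
Qed.

(** * Splitting *)

Context (M a : R) (M_pos : 0 < M) (a_pos : 0 < a).
Context (growth : forall m n, (n <= m)%positive -> forall x,
  N m (fwd A m n x) <= M * Rpower (#m / #n) a * N n x).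

Let G : R := M * Rpower 2 a.

Lemma G_pos : 0 < G.
Proof. apply Rmult_lt_0_compat; [exact M_pos|apply Rpower_pos]. Qed.

Lemma growth_octave (n k : positive) (v : X) :
  (n <= k)%positive -> (k <= 2 * n)%positive -> N k (fwd A k n v) <= G * N n v.
Proof.
  intros Hnk Hk; apply Rle_trans with (1 := growth k n Hnk v).
  apply Rmult_le_compat_r; [apply (is_norm_ge0 (is_norm_N n))|].
  apply Rmult_le_compat_l; [lra|]; apply Rle_Rpower_l; [lra|].
  assert (Hn := real_ge1 n). assert (Hk1 := real_ge1 k).
  assert (Hk2 := real_le _ _ Hk); rewrite Pos2Z.inj_mul mult_IZR in Hk2.
  split; [apply Rdiv_lt_0_compat; lra|].
  apply Rmult_le_reg_r with #n; [lra|].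
  replace (#k / #n * #n) with #k by (field; lra); exact Hk2.
Qed.

(** G bounds the faded orbit, and C (2 G) the bounded solution. *)
Definition splitting_const : R := G + C * (2 * G).

Lemma splitting_const_pos : 0 < splitting_const.
Proof. unfold splitting_const; generalize G_pos C_pos; intros; nra. Qed.

(** The forcing g fades out the orbit of v between n and 2n; phi is the fading
    factor, and Z is reached by the initial value of the bounded solution. *)
Lemma splitting (n : positive) (v : X) :
  exists z, Z z /\
    (forall k, (k <= n)%positive -> N k (fwd A k 1 z) <= splitting_const * N n v) /\
    (forall k, (n <= k)%positive ->
       N k (fwd A k n (minus v (fwd A n 1 z))) <= splitting_const * N n v).
Proof.
  assert (HG := G_pos).
  assert (Hn := real_ge1 n). assert (HNv := is_norm_ge0 (is_norm_N n) v).
  assert (HGv : 0 <= G * N n v) by (apply Rmult_le_pos; lra).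
  set (g k := if ((n <=? k) && (k <? 2 * n))%positive%bool
              then (- / #n) *: fwd A (Pos.succ k) n v else zero).
  assert (Hg_in : forall k, (n <= k < 2 * n)%positive ->
    g k = (- / #n) *: fwd A (Pos.succ k) n v).
  { intros k Hk; unfold g.
    destruct (Pos.leb_spec n k), (Pos.ltb_spec k (2 * n)); try lia; reflexivity. }
  assert (Hg_out : forall k, (k < n \/ 2 * n <= k)%positive -> g k = zero).
  { intros k Hk; unfold g.
    destruct (Pos.leb_spec n k), (Pos.ltb_spec k (2 * n)); try lia; reflexivity. }
  assert (Hg : bounded_by forcing_norm (2 * (G * N n v)) g).
  { intros k; unfold forcing_norm.
    destruct (Pos.ltb_spec k n) as [Hk|Hk];
      [|destruct (Pos.leb_spec (2 * n) k) as [Hk'|Hk']].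
    - rewrite (Hg_out k (or_introl Hk)) (norm_zero_at _ (is_norm_N _)); lra.
    - rewrite (Hg_out k (or_intror Hk')) (norm_zero_at _ (is_norm_N _)); lra.
    - rewrite Hg_in; [|lia].
      rewrite (norm_rscal _ _ _ (is_norm_N _)) Rabs_Ropp Rabs_pos_eq;
        [|apply Rlt_le, Rinv_0_lt_compat; lra].
      rewrite -Rmult_assoc; apply Rmult_le_compat.
      + apply Rmult_le_pos; [generalize (real_ge1 (Pos.succ k)); lra|].
        apply Rlt_le, Rinv_0_lt_compat; lra.
      + apply (is_norm_ge0 (is_norm_N _)).
      + apply Rmult_le_reg_r with #n; [lra|].
        rewrite Rmult_assoc Rinv_l; [|lra].
        assert (H : (Pos.succ k <= 2 * n)%positive) by lia.
        apply real_le in H; rewrite Pos2Z.inj_mul mult_IZR in H; lra.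
      + apply growth_octave; lia. }
  destruct (bounded_solution_exists g _ Hg) as [x [c [Hx Hxc]]].
  assert (H2Gv : 0 <= 2 * (G * N n v)) by lra.
  assert (HxC := bounded_inverse x g _ c Hx Hxc H2Gv Hg).
  destruct Hx as [Hx1 Hx].
  assert (Hback : forall k, (k <= n)%positive -> x k = fwd A k 1 (x 1%positive)).
  { induction k as [|k IH] using Pos.peano_ind; intros Hk; [reflexivity|].
    rewrite Hx fwd_succ; [|lia].
    rewrite IH; [|lia]. rewrite Hg_out; [module_eq|lia]. }
  set (phi k := Rmax 0 (2 - #k / #n)).
  assert (Hphi0 : forall k, (2 * n <= k)%positive -> phi k = 0).
  { intros k Hk; apply real_le in Hk; rewrite Pos2Z.inj_mul mult_IZR in Hk.
    apply Rmax_left, Rmult_le_reg_r with #n; [lra|].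
    replace ((2 - #k / #n) * #n) with (2 * #n - #k) by (field; lra); lra. }
  assert (Hphi1 : forall k, (k <= 2 * n)%positive -> phi k = 2 - #k / #n).
  { intros k Hk; apply real_le in Hk; rewrite Pos2Z.inj_mul mult_IZR in Hk.
    apply Rmax_right, Rmult_le_reg_r with #n; [lra|].
    replace ((2 - #k / #n) * #n) with (2 * #n - #k) by (field; lra); lra. }
  assert (Hforw : forall k, (n <= k)%positive ->
    fwd A k n (minus v (x n)) = minus (phi k *: fwd A k n v) (x k)).
  { assert (Hforw_n : fwd A n n (minus v (x n)) = minus (phi n *: fwd A n n v) (x n)).
    { rewrite !fwd_id; try lia; rewrite Hphi1; [|lia].
      replace (2 - #n / #n) with 1 by (field; lra); module_eq. }
    induction k as [|k IH] using Pos.peano_ind; intros Hk.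
    - replace 1%positive with n by lia; exact Hforw_n.
    - destruct (Pos.eq_dec n (Pos.succ k)) as [<-|Hnk]; [exact Hforw_n|].
        rewrite !fwd_succ; try lia; rewrite IH; [|lia].
        replace (minus (phi k *: fwd A k n v) (x k)) with
          (plus (phi k *: fwd A k n v) ((-(1)) *: x k)) by module_eq.
        rewrite (linear_plus _ (HA k)) !(linear_scal _ (HA k)) Hx.
        destruct (Pos.ltb_spec k (2 * n)) as [Hk2|Hk2].
        * rewrite Hg_in; [|lia]; rewrite fwd_succ; [|lia].
          rewrite !Hphi1; try lia.
          replace (2 - #(Pos.succ k) / #n) with (2 - #k / #n + - / #n)
            by (rewrite succ_real; field; lra).
          module_eq.
        * rewrite Hg_out; [|lia]; rewrite !Hphi0; try lia; module_eq. }
  exists (x 1%positive); split; [exact Hx1|split].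
  - intros k Hk; rewrite -(Hback k Hk); apply Rle_trans with (1 := HxC k).
    unfold splitting_const; lra.
  - intros k Hk; rewrite -(Hback n); [|lia]; rewrite (Hforw k Hk).
    apply Rle_trans with (1 := norm_minus_le _ _ _ (is_norm_N k)).
    unfold splitting_const.
    rewrite Rmult_plus_distr_r; apply Rplus_le_compat;
      [|apply Rle_trans with (1 := HxC k); lra].
    rewrite (norm_rscal _ _ _ (is_norm_N k)).
    destruct (Pos.ltb_spec k (2 * n)) as [Hk2|Hk2].
    + assert (H1 : 1 <= #k / #n).
      { apply Rmult_le_reg_r with #n; [lra|].
        replace (#k / #n * #n) with #k by (field; lra).
        generalize (real_le _ _ Hk); lra. }
      assert (H2 : Rabs (phi k) <= 1).
      { rewrite Rabs_pos_eq; [|apply Rmax_l]. apply Rmax_lub; lra. }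
      apply Rle_trans with (1 * N k (fwd A k n v)).
      * apply Rmult_le_compat_r; [apply (is_norm_ge0 (is_norm_N k))|exact H2].
      * rewrite Rmult_1_l; apply growth_octave; lia.
    + rewrite (Hphi0 k Hk2) Rabs_R0 Rmult_0_l; exact HGv.
Qed.

(** * The projections *)

Definition stable (n : positive) (v : X) : Prop :=
  exists c, forall k, (n <= k)%positive -> N k (fwd A k n v) <= c.

Definition unstable (n : positive) (v : X) : Prop :=
  exists z, Z z /\ v = fwd A n 1 z.

(** Such a v lies on a free orbit starting in Z and bounded for all times, that is
    on a solution for zero forcing. *)
Lemma stable_unstable_zero (n : positive) (v : X) :
  stable n v -> unstable n v -> v = zero.
Proof.
  intros [c Hc] [z [Hz Hv]].
  destruct (argmax (fun k => N k (fwd A k 1 z)) 1 n ltac:(lia)) as [l [_ Hl]].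
  rewrite Hv.
  apply (bounded_solution_unique (fun k => fwd A k 1 z)
    (Rmax c (N l (fwd A l 1 z)))).
  - split; [exact Hz|]; intros m; rewrite fwd_succ; [module_eq|lia].
  - intros k; destruct (Pos.leb_spec k n) as [Hk|Hk].
    + apply Rle_trans with (2 := Rmax_r _ _); apply Hl; lia.
    + apply Rle_trans with (2 := Rmax_l _ _).
      rewrite (fwd_trans k n 1); try lia; rewrite -Hv; apply Hc; lia.
Qed.

Lemma stable_plus (n : positive) (v w : X) :
  stable n v -> stable n w -> stable n (plus v w).
Proof.
  intros [c Hc] [d Hd]; exists (c + d); intros k Hk; rewrite fwd_plus.
  apply Rle_trans with (1 := is_norm_triangle (is_norm_N k) _ _).
  apply Rplus_le_compat; auto.
Qed.

Lemma stable_scal (n : positive) (r : K) (v : X) : stable n v -> stable n (scal r v).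
Proof.
  intros [c Hc]; exists (abs r * c); intros k Hk.
  rewrite fwd_scal (is_norm_scal (is_norm_N k)).
  apply Rmult_le_compat_l; [apply abs_ge_0|auto].
Qed.

Lemma unstable_plus (n : positive) (v w : X) :
  unstable n v -> unstable n w -> unstable n (plus v w).
Proof.
  intros [y [Hy ->]] [z [Hz ->]]; exists (plus y z); rewrite fwd_plus.
  split; [now apply (closed_subspace_plus HZ)|reflexivity].
Qed.

Lemma unstable_scal (n : positive) (r : K) (v : X) :
  unstable n v -> unstable n (scal r v).
Proof.
  intros [z [Hz ->]]; exists (scal r z); rewrite fwd_scal.
  split; [now apply (closed_subspace_scal HZ)|reflexivity].
Qed.

Lemma unstable_minus (n : positive) (v w : X) :
  unstable n v -> unstable n w -> unstable n (minus v w).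
Proof.
  intros Hv Hw; replace (minus v w) with (plus v ((-(1)) *: w)) by module_eq.
  apply unstable_plus; [exact Hv|now apply unstable_scal].
Qed.

Lemma stable_step (n : positive) (v : X) : stable n v -> stable (Pos.succ n) (A n v).
Proof.
  intros [c Hc]; exists c; intros k Hk.
  replace (A n v) with (fwd A (Pos.succ n) n v).
  - rewrite -fwd_trans; try lia; apply Hc; lia.
  - rewrite fwd_succ ?fwd_id; [reflexivity|lia|lia].
Qed.

Lemma unstable_step (n : positive) (v : X) :
  unstable n v -> unstable (Pos.succ n) (A n v).
Proof.
  intros [z [Hz ->]]; exists z; split; [exact Hz|].
  rewrite fwd_succ; [reflexivity|lia].
Qed.

(** A difference which is sent to zero has a finite orbit, so it is stable as well
    as unstable. *)
Lemma fwd_injective_unstable (m n : positive) (v w : X) :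
  (n <= m)%positive -> unstable n v -> unstable n w ->
  fwd A m n v = fwd A m n w -> v = w.
Proof.
  intros Hnm Hv Hw Heq.
  apply minus_zero_eq.
  apply (stable_unstable_zero n); [|now apply unstable_minus].
  destruct (argmax (fun k => N k (fwd A k n (minus v w))) n m Hnm) as [l [_ Hl]].
  exists (N l (fwd A l n (minus v w))); intros k Hk.
  destruct (Pos.leb_spec k m) as [Hkm|Hkm]; [apply Hl; lia|].
  apply Rle_trans with 0; [|apply (is_norm_ge0 (is_norm_N l))].
  assert (E : fwd A k n (minus v w) = zero).
  { rewrite fwd_minus (fwd_trans k m n v) ?(fwd_trans k m n w); try lia.
    rewrite Heq; module_eq. }
  apply Req_le; rewrite -(norm_zero_at _ (is_norm_N k)); f_equal; exact E.
Qed.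

Definition proj (n : positive) (v : X) : X :=
  iota (fun s => stable n s /\ unstable n (minus v s)).

(** The sum of the stable and unstable spaces is direct. *)
Lemma proj_eq (n : positive) (v s : X) :
  stable n s -> unstable n (minus v s) -> proj n v = s.
Proof.
  intros Hs Hu; apply iota_unique; [|split; assumption].
  intros s' [Hs' Hu'].
  apply minus_zero_eq.
  apply (stable_unstable_zero n).
  - replace (minus s' s) with (plus s' ((-(1)) *: s)) by module_eq.
    apply stable_plus; [exact Hs'|now apply stable_scal].
  - replace (minus s' s) with (minus (minus v s) (minus v s')) by module_eq.
    now apply unstable_minus.
Qed.

Lemma proj_splitting (n : positive) (v : X) :
  exists z, Z z /\ minus v (proj n v) = fwd A n 1 z /\
    (forall k, (k <= n)%positive -> N k (fwd A k 1 z) <= splitting_const * N n v) /\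
    (forall k, (n <= k)%positive ->
       N k (fwd A k n (proj n v)) <= splitting_const * N n v).
Proof.
  destruct (splitting n v) as [z [Hz [Hu Hs]]].
  assert (Hp : proj n v = minus v (fwd A n 1 z)).
  { apply proj_eq; [now exists (splitting_const * N n v)|].
    exists z; split; [exact Hz|module_eq]. }
  exists z; rewrite Hp; split; [exact Hz|split; [module_eq|now split]].
Qed.

Lemma stable_proj (n : positive) (v : X) : stable n (proj n v).
Proof.
  destruct (proj_splitting n v) as [z [_ [_ [_ Hs]]]].
  now exists (splitting_const * N n v).
Qed.

Lemma unstable_proj (n : positive) (v : X) : unstable n (minus v (proj n v)).
Proof.
  destruct (proj_splitting n v) as [z [Hz [Hq _]]]; now exists z.
Qed.

Lemma ker_proj (n : positive) (v : X) : ker (proj n) v <-> unstable n v.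
Proof.
  unfold ker; split; intros Hv.
  - replace v with (minus v (proj n v)); [apply unstable_proj|].
    rewrite Hv; module_eq.
  - apply proj_eq.
    + exists 0; intros k _; replace (zero : X) with (0 *: v) by module_eq.
      rewrite fwd_scal (norm_rscal _ _ _ (is_norm_N k)) Rabs_R0; lra.
    + destruct Hv as [z [Hz ->]]; exists z; split; [exact Hz|module_eq].
Qed.

Lemma proj_plus (n : positive) (v w : X) :
  proj n (plus v w) = plus (proj n v) (proj n w).
Proof.
  apply proj_eq; [apply stable_plus; apply stable_proj|].
  replace (minus (plus v w) (plus (proj n v) (proj n w))) with
    (plus (minus v (proj n v)) (minus w (proj n w))) by module_eq.
  apply unstable_plus; apply unstable_proj.
Qed.

Lemma proj_scal (n : positive) (r : K) (v : X) :
  proj n (scal r v) = scal r (proj n v).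
Proof.
  apply proj_eq; [apply stable_scal, stable_proj|].
  rewrite -scal_minus_distr_l; apply unstable_scal, unstable_proj.
Qed.

Lemma proj_is_projection (n : positive) : is_projection (proj n).
Proof.
  split; [split|].
  - exact (proj_plus n).
  - exact (proj_scal n).
  - destruct (HN n) as [_ [c [c' [Hc [Hc' Heq]]]]].
    assert (HK := splitting_const_pos).
    exists (splitting_const * c' / c); split.
    { apply Rdiv_lt_0_compat; [apply Rmult_lt_0_compat|]; lra. }
    intros v; destruct (proj_splitting n v) as [_ [_ [_ [_ Hs]]]].
    specialize (Hs n ltac:(lia)); rewrite fwd_id in Hs; [|lia].
    apply Rmult_le_reg_l with c; [lra|].
    apply Rle_trans with (1 := proj1 (Heq _)).
    apply Rle_trans with (1 := Hs).
    apply Rle_trans with (splitting_const * (c' * norm v));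
      [apply Rmult_le_compat_l; [lra|apply Heq]|right; field; lra].
  - intros v; apply proj_eq; [apply stable_proj|].
    replace (minus (proj n v) (proj n v)) with
      (minus (minus v (proj n v)) (minus v (proj n v))) by module_eq.
    apply unstable_minus; apply unstable_proj.
Qed.

Lemma proj_invariant (n : positive) (v : X) :
  A n (proj n v) = proj (Pos.succ n) (A n v).
Proof.
  symmetry; apply proj_eq; [apply stable_step, stable_proj|].
  replace (minus (A n v) (A n (proj n v))) with (A n (minus v (proj n v))).
  - apply unstable_step, unstable_proj.
  - replace (minus v (proj n v)) with (plus v ((-(1)) *: proj n v)) by module_eq.
    rewrite (linear_plus _ (HA n)) (linear_scal _ (HA n)); module_eq.
Qed.

Lemma step_bijective (n : positive) :
  bij_between (ker (proj n)) (ker (proj (Pos.succ n))) (A n).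
Proof.
  split.
  - intros v Hv; apply ker_proj, unstable_step, ker_proj, Hv.
  - intros w Hw; apply ker_proj in Hw; destruct Hw as [z [Hz ->]].
    assert (Hu : unstable n (fwd A n 1 z)) by now exists z.
    exists (fwd A n 1 z); split.
    + split; [now apply ker_proj|rewrite fwd_succ; [reflexivity|lia]].
    + intros v [Hv Heq]; apply ker_proj in Hv.
      apply (fwd_injective_unstable (Pos.succ n) n); [lia|exact Hu|exact Hv|].
      rewrite !(fwd_succ n n); try lia; rewrite !(fwd_id n n); try lia.
      rewrite Heq fwd_succ; [reflexivity|lia].
Qed.

Lemma evol_backward (m n : positive) (z : X) :
  (m <= n)%positive -> Z z -> evol A proj m n (fwd A n 1 z) = fwd A m 1 z.
Proof.
  intros Hmn Hz; unfold evol.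
  assert (Hu : unstable m (fwd A m 1 z)) by now exists z.
  destruct (Pos.leb_spec n m) as [Hnm|Hnm].
  - replace m with n by lia; apply fwd_id; lia.
  - assert (Hz' : fwd A n m (fwd A m 1 z) = fwd A n 1 z).
    { symmetry; apply fwd_trans; lia. }
    apply iota_unique.
    + intros y [Hy Heq]; apply ker_proj in Hy.
      apply (fwd_injective_unstable n m); [lia|exact Hy|exact Hu|].
      now rewrite Hz'.
    + split; [now apply ker_proj|exact Hz'].
Qed.

Lemma dichotomy : polynomial_dichotomy A N.
Proof.
  exists proj; split; [split; [exact proj_is_projection|split;
    [exact proj_invariant|exact step_bijective]]|].
  assert (HK := splitting_const_pos).
  exists lam, (2 * splitting_const); split; [lra|split; [lra|]].
  assert (Hswap : forall r y c, Rpower r lam * y <= 2 * c ->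
    y <= 2 * (Rpower r (- lam) * c)).
  { intros r y c H; rewrite Rpower_Ropp.
    assert (Hr := Rpower_pos r lam).
    apply Rmult_le_reg_l with (Rpower r lam); [exact Hr|].
    apply Rle_trans with (1 := H); right; field; lra. }
  intros v m n; destruct (proj_splitting n v) as [z [Hz [Hq [Hu Hs]]]].
  split; intros Hmn.
  - unfold evol; destruct (Pos.leb_spec n m) as [_|H]; [|lia].
    apply Rle_trans with (1 := Hswap _ _ _ (stable_decay n (proj n v) _ Hs m Hmn)).
    right; ring.
  - rewrite Hq evol_backward; [|exact Hmn|exact Hz].
    apply Rle_trans with (1 := Hswap _ _ _ (unstable_decay n z _ Hz Hu m Hmn)).
    right; ring.
Qed.

End Dichotomy.

Theorem theorem3 :
  forall (K : AbsRing), real_or_complex K ->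
  forall (X : CompleteNormedModule K)
    (A : positive -> X -> X) (N : positive -> X -> R),
  (forall m, is_linear (A m)) ->
  (forall m, equivalent_norm (N m)) ->
  (exists Z : X -> Prop, closed_subspace Z /\ T_invertible A N Z) ->
  (exists M a : R, 0 < M /\ 0 < a /\
     forall (m n : positive), (n <= m)%positive ->
     forall x : X,
       N m (fwd A m n x) <=
         M * Rpower (IZR (Zpos m) / IZR (Zpos n)) a * N n x) ->
  polynomial_dichotomy A N.
Proof.
  intros K HK X A N HA HN [Z [HZ HT]] [M [a [HM [Ha Hgrowth]]]].
  destruct (real_embedding_exists K HK) as [rho Hrho].
  destruct (admissibility rho Hrho A N HA HN Z HZ HT) as [C [HC Hbound]].
  apply (dichotomy rho Hrho A N HA HN Z HZ HT C HC Hbound) with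
    (lam := / (8 * C + 2)) (M := M) (a := a); try assumption.
  - split; [apply Rinv_0_lt_compat; lra|].
    apply Rinv_le_contravar; lra.
  - apply Rmult_le_reg_r with (8 * C + 2); [lra|].
    replace (8 * / (8 * C + 2) * C * (8 * C + 2)) with (8 * C) by (field; lra).
    lra.
Qed.
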